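(* A group $G$ is circularly orderable if and only if for every finite subset $X \subset G$ there exist a homomorphism $\phi : \langle X \rangle \to C$ onto a circularly ordered group $C$ and an antisymmetric semigroup $S \subset \ker(\phi)$ such that $X^{-1}X \cap \ker(\phi) \subset S \cup S^{-1} \cup \{id\}$.
   Context: A \emph{circular ordering} of a group $G$ is a function $c : G^3 \to \{0, \pm 1\}$ such that: (1) $c(x_1,x_2,x_3) = 0$ if and only if $x_i = x_j$ for some $i \neq j$; (2) $c(x_1,x_2,x_3) - c(x_1,x_2,x_4) + c(x_1,x_3,x_4) - c(x_2,x_3,x_4) = 0$ for all $x_1,x_2,x_3,x_4 \in G$; (3) $c(yx_1,yx_2,yx_3) = c(x_1,x_2,x_3)$ for all $y,x_1,x_2,x_3 \in G$. A group is \emph{circularly orderable} if it admits a circular ordering; a \emph{circularly ordered group} is a group equipped with a circular ordering (the trivial group is allowed). $\langle X \rangle$ is the subgroup generated by $X$, and $X^{-1}X = \{x^{-1}y \mid x,y \in X\}$. A semigroup $S \subset G$ is a subset closed under multiplication (the empty set is allowed); $S^{-1} = \{s^{-1} \mid s \in S\}$; $S$ is \emph{antisymmetric} if $S \cap S^{-1} = \emptyset$. *)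

(* Defs.v *)
From HB Require Import structures.
From mathcomp Require Import all_boot ssralg ssrint.
From mathcomp Require Import boolp classical_sets functions cardinality.

Set Implicit Arguments.
Unset Strict Implicit.
Unset Printing Implicit Defensive.

Local Open Scope classical_set_scope.
Local Open Scope group_scope.

(* A group is an arbitrary, possibly infinite, [groupType].  The choice
   structure that [groupType] includes exists on every type by the axioms of
   [boolp], so it is no restriction. *)

Section CircularOrdering.
Variable G : groupType.

Record circular_ordering (c : G -> G -> G -> int) : Prop := CircularOrdering {
  circ_val : forall x1 x2 x3,
    [\/ c x1 x2 x3 = 0%R, c x1 x2 x3 = 1%R | c x1 x2 x3 = (-1)%R];
  circ_eq0 : forall x1 x2 x3,
    c x1 x2 x3 = 0%R <-> [\/ x1 = x2, x1 = x3 | x2 = x3];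
  circ_cocycle : forall x1 x2 x3 x4,
    (c x1 x2 x3 - c x1 x2 x4 + c x1 x3 x4 - c x2 x3 x4 = 0)%R;
  circ_mull : forall y x1 x2 x3,
    c (y * x1) (y * x2) (y * x3) = c x1 x2 x3 }.

Definition circularly_orderable : Prop := exists c, circular_ordering c.

End CircularOrdering.

Section Subsets.
Variable G : groupType.
Implicit Types X S H : set G.

Definition inv_set S : set G := [set s^-1 | s in S].

Definition ldiv_set X : set G := [set x^-1 * y | x in X & y in X].

Definition is_semigroup S : Prop := forall s t, S s -> S t -> S (s * t).

Definition antisymmetric_set S : Prop := S `&` inv_set S = set0.

Definition is_subgroup H : Prop :=
  [/\ H 1, forall x y, H x -> H y -> H (x * y) & forall x, H x -> H x^-1].

Definition gen X : set G := smallest is_subgroup X.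

Lemma gen_is_subgroup X : is_subgroup (gen X).
Proof.
split=> [H [[]] // | x y gx gy H HX | x gx H HX].
  by have [[_ HM _] _] := HX; apply: HM; [apply: gx | apply: gy].
by have [[_ _ HV] _] := HX; apply: HV; apply: gx.
Qed.

Definition gen_pred X : pred G := [pred x | x \in gen X].

Lemma gen_group_closed X : group_closed (gen_pred X).
Proof.
have [g1 gM gV] := gen_is_subgroup X; split; first exact/mem_set.
move=> x y /set_mem gx /set_mem gy; apply/mem_set.
by apply: gM => //; apply: gV.
Qed.

Definition gen_group X : Type := {x : G | gen_pred X x}.

HB.instance Definition _ X :=
  SubChoice.copy (gen_group X) {x : G | gen_pred X x}.
HB.instance Definition _ X :=
  SubChoice_isSubGroup.Build G (gen_pred X) (gen_group X) (gen_group_closed X).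

(* The kernel is taken as a subset of the ambient group G. *)
Definition ker X (C : groupType) (phi : gen_group X -> C) : set G :=
  [set val u | u in [set u | phi u = 1]].

End Subsets.

(* Main.v *)
Require Import Defs.
From HB Require Import structures.
From mathcomp Require Import all_boot ssralg ssrint.
From mathcomp Require Import boolp classical_sets functions cardinality.
From mathcomp Require Import filter zify.

(* Forward: restrict the ordering to <X> and take phi = id, S = empty.

   Backward: let o be the sign function of the left-invariant partial order on
   <X> whose positive cone is S.  Then the pullback by phi of the ordering of C
   plus the coboundary of o is a left-invariant cocycle on <X>; on X, where o
   totally orders the fibres of phi, it is the lexicographic circular ordering,
   so it takes its values in {0, 1, -1} and vanishes exactly on the degenerate
   triples.  An ultralimit of these functions along the finite subsets X of G
   is a circular ordering. *)

Set Implicit Arguments.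
Unset Strict Implicit.

Local Open Scope classical_set_scope.
Local Open Scope group_scope.

(** * Compactness: from finite subsets to the whole group *)

Section CircularOrderingOn.
Variable G : groupType.

(** [c] is total on [G] because the products [y * x1] in the invariance axiom may leave [X]; only
    there do values off [X] matter. *)
Record circular_ordering_on (X : set G) (c : G -> G -> G -> int) : Prop :=
  CircularOrderingOn {
  circ_on_val : forall x1 x2 x3, X x1 -> X x2 -> X x3 ->
    [\/ c x1 x2 x3 = 0%R, c x1 x2 x3 = 1%R | c x1 x2 x3 = (-1)%R];
  circ_on_eq0 : forall x1 x2 x3, X x1 -> X x2 -> X x3 ->
    c x1 x2 x3 = 0%R <-> [\/ x1 = x2, x1 = x3 | x2 = x3];
  circ_on_cocycle : forall x1 x2 x3 x4, X x1 -> X x2 -> X x3 -> X x4 ->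
    (c x1 x2 x3 - c x1 x2 x4 + c x1 x3 x4 - c x2 x3 x4 = 0)%R;
  circ_on_mull : forall y x1 x2 x3, X y -> X x1 -> X x2 -> X x3 ->
    c (y * x1) (y * x2) (y * x3) = c x1 x2 x3 }.

(** An ultrafilter that contains a union of three pieces contains one of them. *)
Lemma ultrafilter_sign_limit (I : Type) (U : set_system I) (f : I -> int) :
    UltraFilter U ->
    U [set i | [\/ f i = 0%R, f i = 1%R | f i = (-1)%R]] ->
  exists v, U [set i | f i = v].
Proof.
move=> UU Uf.
have [|n0] := in_ultra_setVsetC [set i | f i = 0%R] UU; first by exists 0%R.
have [|n1] := in_ultra_setVsetC [set i | f i = 1%R] UU; first by exists 1%R.
exists (-1)%R; apply: filterS (filterI Uf (filterI n0 n1)).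
by move=> i [[] // fi [/= ? ?]].
Qed.

Lemma circularly_orderable_compact :
    (forall X : set G, finite_set X -> exists c, circular_ordering_on X c) ->
  circularly_orderable G.
Proof.
move=> locG.
have /choice[d dP] (X : set G) :
    exists c, finite_set X -> circular_ordering_on X c.
  have [/locG[c cP]|nX] := pselect (finite_set X); first by exists c.
  by exists (fun _ _ _ => 0%R).
(* The cones of finite supersets form a filter base, since the cone over [Y] and the cone over [Z]
   meet in the cone over their union. *)
pose B (Y : set G) := [set X | finite_set X /\ Y `<=` X].
have BF : ProperFilter (filter_from finite_set B).
  apply: filter_from_proper => [|Y finY]; last by exists Y; split.
  apply: filter_from_filter => [|Y Z finY finZ]; first by exists set0.
  exists (Y `|` Z); first by rewrite finite_setU.
  by move=> X [finX]; rewrite subUset => -[].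
have [U [UU BU]] := ultraFilterLemma BF.
have Uset Y : finite_set Y ->
    U [set X | circular_ordering_on X (d X) /\ Y `<=` X].
  move=> finY; apply: BU; exists Y => // X [finX YX].
  by split; first exact: dP.
have /choice[e eP] (t : G * G * G) :
    exists v, U [set X | d X t.1.1 t.1.2 t.2 = v].
  case: t => -[x1 x2] x3; apply: ultrafilter_sign_limit => /=.
  have /Uset : finite_set [set x1; x2; x3] by [].
  apply: filterS => X [dX sX].
  by apply: (circ_on_val dX); apply: sX => /=; auto.
pose c x1 x2 x3 := e (x1, x2, x3).
have cP x1 x2 x3 : U [set X | d X x1 x2 x3 = c x1 x2 x3].
  exact: (eP (x1, x2, x3)).
(* Each instance of an axiom involves finitely many elements and values, so a single [X] contains
   those elements and has [d X] agreeing with [c] on those values. *)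
exists c; split=> [x1 x2 x3|x1 x2 x3|x1 x2 x3 x4|y x1 x2 x3].
- have /Uset UX : finite_set [set x1; x2; x3] by [].
  have [X [[dX sX] /= <-]] := filter_ex (filterI UX (cP x1 x2 x3)).
  by apply: (circ_on_val dX); apply: sX => /=; auto.
- have /Uset UX : finite_set [set x1; x2; x3] by [].
  have [X [[dX sX] /= <-]] := filter_ex (filterI UX (cP x1 x2 x3)).
  by apply: (circ_on_eq0 dX); apply: sX => /=; auto.
- have /Uset UX : finite_set [set x1; x2; x3; x4] by [].
  have [X [[dX sX] [/= <- [/= <- [/= <- /= <-]]]]] := filter_ex
    (filterI UX (filterI (cP x1 x2 x3) (filterI (cP x1 x2 x4)
      (filterI (cP x1 x3 x4) (cP x2 x3 x4))))).
  by apply: (circ_on_cocycle dX); apply: sX => /=; auto.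
- have /Uset UX : finite_set [set y; x1; x2; x3] by [].
  have [X [[dX sX] [/= <- /= <-]]] := filter_ex
    (filterI UX (filterI (cP (y * x1) (y * x2) (y * x3)) (cP x1 x2 x3))).
  by apply: (circ_on_mull dX); apply: sX => /=; auto.
Qed.

End CircularOrderingOn.

(** * The sign function of the partial order with positive cone [S] *)

Section ConeSign.
Variables (G : groupType) (S : set G).
Hypotheses (S_mul : is_semigroup S) (S_anti : antisymmetric_set S).

(** The value 0 covers both equal and incomparable elements. *)
Definition cone_sign (x y : G) : int :=
  if `[< S (x^-1 * y) >] then 1%R
  else if `[< S (y^-1 * x) >] then (-1)%R else 0%R.

Lemma cone_asym x y : S (x^-1 * y) -> ~ S (y^-1 * x).
Proof.
move=> Sxy Syx; suff: (S `&` inv_set S) (x^-1 * y) by rewrite S_anti.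
by split=> //; exists (y^-1 * x) => //; rewrite invgM invgK.
Qed.

Lemma cone_trans x y z : S (x^-1 * y) -> S (y^-1 * z) -> S (x^-1 * z).
Proof. by move=> Sxy Syz; move: (S_mul Sxy Syz); rewrite mulgA mulgK. Qed.

Variant cone_sign_spec (x y : G) : int -> Prop :=
  | ConeSignPos of S (x^-1 * y) & ~ S (y^-1 * x) : cone_sign_spec x y 1%R
  | ConeSignNeg of S (y^-1 * x) & ~ S (x^-1 * y) : cone_sign_spec x y (-1)%R
  | ConeSign0 of ~ S (x^-1 * y) & ~ S (y^-1 * x) : cone_sign_spec x y 0%R.

Lemma cone_signP x y : cone_sign_spec x y (cone_sign x y).
Proof.
rewrite /cone_sign; case: asboolP => [Sxy|nSxy].
  by constructor=> //; apply: cone_asym.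
by case: asboolP => Syx; constructor.
Qed.

Lemma cone_sign_mull z x y : cone_sign (z * x) (z * y) = cone_sign x y.
Proof. by rewrite /cone_sign !invgM -!mulgA !mulKg. Qed.

Lemma cone_signxx x : cone_sign x x = 0%R.
Proof. by case: cone_signP. Qed.

End ConeSign.

(** * The lexicographic cocycle and its values *)

Section Lexicographic.
Variables (G C : groupType) (c : C -> C -> C -> int).
Variables (phi : {multiplicative G -> C}) (S : set G).
Hypotheses (c_circ : circular_ordering c).
Hypotheses (S_mul : is_semigroup S) (S_anti : antisymmetric_set S).
Hypothesis S_ker : forall x, S x -> phi x = 1.

Local Notation o := (cone_sign S).

Definition lex_circ (x1 x2 x3 : G) : int :=
  (c (phi x1) (phi x2) (phi x3) + (o x1 x2 + o x2 x3 - o x1 x3))%R.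

Lemma lex_circ_cocycle x1 x2 x3 x4 :
  (lex_circ x1 x2 x3 - lex_circ x1 x2 x4
   + lex_circ x1 x3 x4 - lex_circ x2 x3 x4 = 0)%R.
Proof.
have := circ_cocycle c_circ (phi x1) (phi x2) (phi x3) (phi x4).
by rewrite /lex_circ; lia.
Qed.

Lemma lex_circ_mull y x1 x2 x3 :
  lex_circ (y * x1) (y * x2) (y * x3) = lex_circ x1 x2 x3.
Proof. by rewrite /lex_circ !gmulfM (circ_mull c_circ) !cone_sign_mull. Qed.

Lemma cone_fibre x y : S (x^-1 * y) -> phi x = phi y.
Proof. by move/S_ker=> e; rewrite -[y](mulVKg x) gmulfM e mulg1. Qed.

(** The cases are the coincidences among the images under [phi]. With three distinct images the [o]
    terms vanish and [c] is nonzero. With exactly two equal, [c] and all [o] terms but one vanish.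
    With all equal, [c] vanishes and [o] is a strict total order on the three points. *)
Lemma lex_circ_sign x1 x2 x3 (X : set G) :
    (forall x y, X x -> X y -> phi x = phi y ->
      [\/ x = y, S (x^-1 * y) | S (y^-1 * x)]) ->
    X x1 -> X x2 -> X x3 ->
  [\/ lex_circ x1 x2 x3 = 0%R, lex_circ x1 x2 x3 = 1%R
    | lex_circ x1 x2 x3 = (-1)%R]
  /\ (lex_circ x1 x2 x3 = 0%R <-> [\/ x1 = x2, x1 = x3 | x2 = x3]).
Proof.
move=> tot X1 X2 X3; rewrite /lex_circ.
have c0 := circ_eq0 c_circ (phi x1) (phi x2) (phi x3).
have o0 x y : phi x <> phi y -> o x y = 0%R.
  by move=> nxy; case: cone_signP => // [/cone_fibre|/cone_fibre/esym].
have oxx := cone_signxx S_anti.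
have o_val x y : [\/ o x y = 0%R, o x y = 1%R | o x y = (-1)%R].
  by case: cone_signP => // _ _; [constructor 2|constructor 3|constructor 1].
have o_eq0 x y : X x -> X y -> phi x = phi y -> o x y = 0%R -> x = y.
  move=> Xx Xy exy; case: cone_signP => // nSxy nSyx _.
  by case: (tot x y Xx Xy exy).
have oN x y : o y x = (- o x y)%R.
  by case: (cone_signP S_anti x y) => Sxy nSyx; case: cone_signP.
have o_trans x y z : o x y = 1%R -> o y z = 1%R -> o x z = 1%R.
  case: cone_signP => // Sxy _ _; case: cone_signP => // Syz _ _.
  by case: cone_signP (cone_trans S_mul Sxy Syz).
have degenerate : [\/ x1 = x2, x1 = x3 | x2 = x3] ->
    (c (phi x1) (phi x2) (phi x3) + (o x1 x2 + o x2 x3 - o x1 x3) = 0)%R.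
  move=> x123; have -> : c (phi x1) (phi x2) (phi x3) = 0%R.
    by apply/c0; case: x123 => ->; [constructor 1|constructor 2|constructor 3].
  case: x123 => ->; rewrite oxx; try lia.
  (* Only [x1 = x3] remains: the two surviving [o] terms are opposite. *)
  by have := oN x2 x3; lia.
have [x123|nondeg] := pselect [\/ x1 = x2, x1 = x3 | x2 = x3].
  by rewrite degenerate //; split; [constructor 1|].
have [n12 n13 n23] : [/\ x1 <> x2, x1 <> x3 & x2 <> x3].
  by split=> e; apply: nondeg; [constructor 1|constructor 2|constructor 3].
suff : [\/ c (phi x1) (phi x2) (phi x3) + (o x1 x2 + o x2 x3 - o x1 x3) = 1
    | c (phi x1) (phi x2) (phi x3) + (o x1 x2 + o x2 x3 - o x1 x3) = -1]%R.
  by move=> [] ->; split=> //; [constructor 2|constructor 3].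
have o_pm1 x y : X x -> X y -> phi x = phi y -> x <> y ->
    o x y = 1%R \/ o x y = (-1)%R.
  move=> Xx Xy exy nxy; case: (o_val x y); [|by left|by right].
  by move/(o_eq0 _ _ Xx Xy exy).
have [e12|d12] := pselect (phi x1 = phi x2).
  have -> : c (phi x1) (phi x2) (phi x3) = 0%R by apply/c0; constructor 1.
  have [e13|d13] := pselect (phi x1 = phi x3); last first.
    rewrite (o0 x2 x3) -?e12 // (o0 x1 x3) //.
    by have [] := o_pm1 _ _ X1 X2 e12 n12; [left|right]; lia.
  have e23 : phi x2 = phi x3 by rewrite -e12.
  (* Three signs have an odd sum, so only 3 and -3 must be excluded; each would make [o] cyclic on
     the triple, against one of these two instances of transitivity. *)
  have := o_trans x1 x2 x3; have := o_trans x3 x2 x1.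
  have := oN x1 x2; have := oN x2 x3; have := oN x1 x3.
  have := o_pm1 _ _ X1 X2 e12 n12; have := o_pm1 _ _ X1 X3 e13 n13.
  have := o_pm1 _ _ X2 X3 e23 n23.
  lia.
have [e23|d23] := pselect (phi x2 = phi x3).
  have -> : c (phi x1) (phi x2) (phi x3) = 0%R by apply/c0; constructor 3.
  rewrite (o0 x1 x2) // (o0 x1 x3) -?e23 //.
  by have := o_pm1 _ _ X2 X3 e23 n23; lia.
rewrite (o0 x1 x2) // (o0 x2 x3) //.
have [e13|d13] := pselect (phi x1 = phi x3).
  have -> : c (phi x1) (phi x2) (phi x3) = 0%R by apply/c0; constructor 2.
  by have := o_pm1 _ _ X1 X3 e13 n13; lia.
rewrite (o0 x1 x3) //.
have [/c0[]||] // := circ_val c_circ (phi x1) (phi x2) (phi x3); lia.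
Qed.

End Lexicographic.

(** * Transfer from the generated subgroup to [G] *)

Section GenGroupVal.
Variables (G : groupType) (X : set G).
Implicit Types u v : gen_group X.

Lemma gen_valM u v : val (u * v) = val u * val v. Proof. exact: valM. Qed.

Lemma gen_val1 : val (1 : gen_group X) = 1. Proof. exact: val1. Qed.

Lemma gen_valV u : val u^-1 = (val u)^-1.
Proof.
by apply: (mulgI (val u)); rewrite -gen_valM !mulgV gen_val1.
Qed.

End GenGroupVal.

Lemma circular_ordering_on_extension (G : groupType) (X : set G)
    (C : groupType) (c : C -> C -> C -> int)
    (phi : {multiplicative gen_group X -> C}) (S : set G) :
    circular_ordering c -> is_semigroup S -> antisymmetric_set S ->
    S `<=` ker phi ->
    ldiv_set X `&` ker phi `<=` S `|` inv_set S `|` [set 1] ->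
  exists d, circular_ordering_on X d.
Proof.
move=> c_circ S_mul S_anti S_ker S_tot.
pose T : set (gen_group X) := [set u | S (val u)].
have T_mul : is_semigroup T.
  by move=> u v Tu Tv; rewrite /T /mkset gen_valM; apply: S_mul.
have T_anti : antisymmetric_set T.
  rewrite /antisymmetric_set -subset0 => u [Tu [v Tv vu]].
  suff : (S `&` inv_set S) (val u) by rewrite S_anti.
  by split=> //; exists (val v) => //; rewrite -vu gen_valV.
have T_ker u : T u -> phi u = 1 by move=> /S_ker[v /= v1 /val_inj <-].
(* A retraction onto the subgroup; the default 1 outside it is never met, since only elements of [X]
   and their products are evaluated. *)
pose r : G -> gen_group X := insubd (1 : gen_group X).
have rK x : gen X x -> val (r x) = x.
  by move=> gx; rewrite insubdK //; apply/mem_set.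
have Xgen : X `<=` gen X by move=> x Xx H [_]; apply.
have rM y x : X y -> X x -> r (y * x) = r y * r x.
  move=> /Xgen gy /Xgen gx; apply: val_inj; rewrite gen_valM !rK //.
  by have [_ gM _] := gen_is_subgroup X; apply: gM.
(* Two points of [X] in one fibre have their quotient in both [ldiv_set X] and the kernel, which is
   what the covering hypothesis controls. *)
have T_tot u v : X (val u) -> X (val v) -> phi u = phi v ->
    [\/ u = v, T (u^-1 * v) | T (v^-1 * u)].
  move=> Xu Xv phi_uv.
  have uv1 : phi (u^-1 * v) = 1.
    apply: (mulgI (phi u)); rewrite -gmulfM mulVKg mulg1; exact: esym.
  have [] : (S `|` inv_set S `|` [set 1]) (val (u^-1 * v)).
  - apply: S_tot; split; last by exists (u^-1 * v).
    by exists (val u) => //; exists (val v) => //; rewrite gen_valM gen_valV.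
  - case=> [Suv|[s Ss suv]]; first by constructor 2.
    constructor 3; suff e : val (v^-1 * u) = s by rewrite /T /mkset e.
    by rewrite -[s]invgK suv -gen_valV invgM invgK.
  - move=> uv; constructor 1; apply: val_inj; apply: (mulgI (val u)^-1).
    by rewrite mulVg -gen_valV -gen_valM uv.
pose sgn := lex_circ_sign c_circ T_mul T_anti T_ker T_tot.
have Xr x : X x -> X (val (r x)) by move=> Xx; rewrite rK //; apply: Xgen.
exists (fun x1 x2 x3 => lex_circ c phi T (r x1) (r x2) (r x3)).
split=> [x1 x2 x3 X1 X2 X3|x1 x2 x3 X1 X2 X3|x1 x2 x3 x4 _ _ _ _|].
- by have [] := sgn _ _ _ (Xr _ X1) (Xr _ X2) (Xr _ X3).
- have [_ ->] := sgn _ _ _ (Xr _ X1) (Xr _ X2) (Xr _ X3).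
  have r_inj x y : X x -> X y -> r x = r y -> x = y.
    by move=> /Xgen/rK + /Xgen/rK => {2}<- {2}<- ->.
  split=> [[]|[]->]; by [constructor 1; apply: r_inj|constructor 2; apply: r_inj
    |constructor 3; apply: r_inj|constructor 1|constructor 2|constructor 3].
- exact: lex_circ_cocycle.
(* The translates may leave [X] but stay in the generated subgroup, where [r] is multiplicative and
   [lex_circ] is invariant. *)
- by move=> y x1 x2 x3 Xy X1 X2 X3; rewrite !rM // lex_circ_mull.
Qed.

Theorem theorem2p16 (G : groupType) :
  circularly_orderable G <->
  (forall X : set G, finite_set X ->
    exists (C : groupType) (c : C -> C -> C -> int)
           (phi : {multiplicative gen_group X -> C}) (S : set G),
      circular_ordering c /\
      set_surj setT setT phi /\
      is_semigroup S /\
      antisymmetric_set S /\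
      S `<=` ker phi /\
      ldiv_set X `&` ker phi `<=` S `|` inv_set S `|` [set 1]).
Proof.
split=> [[c cP] X _|H]; last first.
  apply: circularly_orderable_compact => X /H.
  move=> [C [d [phi [S [dP [_ [SM [SA [Sker Stot]]]]]]]]].
  exact: circular_ordering_on_extension dP SM SA Sker Stot.
pose c' (u v w : gen_group X) := c (val u) (val v) (val w).
have c'P : circular_ordering c'.
  split=> [u v w|u v w|u v w t|t u v w].
  - exact: (circ_val cP).
  - rewrite /c' (circ_eq0 cP).
    split=> [[/val_inj|/val_inj|/val_inj]|[]] ->;
      by [constructor 1|constructor 2|constructor 3].
  - exact: (circ_cocycle cP).
  - by rewrite /c' !gen_valM (circ_mull cP).
have idM : {morph @id (gen_group X) : x y / x * y} by [].
pose phi : {multiplicative gen_group X -> gen_group X} :=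
  HB.pack (@id (gen_group X)) (isMultiplicative.Build _ _ _ idM).
exists (gen_group X), c', phi, set0; split=> //.
split; first by move=> u _; exists u.
split=> //; split; first by rewrite /antisymmetric_set set0I.
(* The identity has trivial kernel, so the singleton of 1 alone covers the intersection. *)
split=> // x [_ [u /= u1 <-]]; right.
by rewrite /= (u1 : u = 1) gen_val1.
Qed.
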